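(* Let $\Theta_0,\Theta_1\notin\mathbb Z$, $\hat s_1\in\mathbb C$, $r\in\mathbb C\setminus\{0\}$, and put $b=\frac{\Theta_1+\Theta_0}2$, $c=\frac{\Theta_1-\Theta_0}2$, $d=\frac{\Theta_\infty}2$. The function $\zeta(t)$ corresponding to the logarithmic solution of the isomonodromy deformation system with parameters $(\hat s_1,r)$ described in the context has the following asymptotic expansion as $t\to0$: \begin{align*} \zeta(t)&=-bc+(b-c)d+t(\ln t+\hat s_1)\big(dbc(\ln t+\hat s_1)-db-bc-cd-2bcd\big)\\ &\quad+t\,(b+d+db+bc+cd+2dbc)+\mathcal O\big(t^2\ln^4t\big). \end{align*}
   Context: **Isomonodromy deformation system** with complex parameters $\Theta_0,\Theta_1,\Theta_\infty$: \begin{align*} t\frac{dy}{dt}&=ty-2z(y-1)^2-(y-1)\Big(\tfrac{\Theta_0-\Theta_1+\Theta_\infty}2y-\tfrac{3\Theta_0+\Theta_1+\Theta_\infty}2\Big),\\ t\frac{dz}{dt}&=yz\Big(z+\tfrac{\Theta_0-\Theta_1+\Theta_\infty}2\Big)-\frac1y(z+\Theta_0)\Big(z+\tfrac{\Theta_0+\Theta_1+\Theta_\infty}2\Big),\\ t\frac{d}{dt}\log u&=-2z-\Theta_0+y\Big(z+\tfrac{\Theta_0-\Theta_1+\Theta_\infty}2\Big)+\frac1y\Big(z+\tfrac{\Theta_0+\Theta_1+\Theta_\infty}2\Big). \end{align*} **$\zeta$-function:** $$\zeta(t)=\tfrac14\big((\Theta_0+\Theta_\infty)^2-\Theta_1^2\big)-zt-\Big(z-\tfrac1y\big(z+\tfrac{\Theta_0+\Theta_1+\Theta_\infty}2\big)\Big)\Big(z+\Theta_0-y\big(z+\tfrac{\Theta_0-\Theta_1+\Theta_\infty}2\big)\Big);$$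 on solutions $\zeta'(t)=-z$. **Logarithmic solution with parameters $(\hat s_1,r)$:** the solution with the asymptotic expansion, as $t\to0$, \begin{align*} z&=-dbc(\ln t+\hat s_1)^2+(bc+(b+c)d)(\ln t+\hat s_1)-d-b+\varepsilon,\\ u&=-r\,t^{\Theta_\infty}\,\frac{db(\ln t+\hat s_1)-b-d+\varepsilon}{db(\ln t+\hat s_1)-\frac12+\varepsilon},\\ y&=\frac{\big(-dbc(\ln t+\hat s_1)+db+bc+cd+\varepsilon\big)\big(b(\ln t+\hat s_1)-1+\varepsilon\big)}{\big(-bc(\ln t+\hat s_1)+b+c+\varepsilon\big)\big(db(\ln t+\hat s_1)-b-d+\varepsilon\big)}, \end{align*} where $\varepsilon$ stands for error terms $\mathcal O(t\ln^4t)$. $\arg t$ is fixed in the standard way ($\arg t=0$ for $t>0$) and is bounded as $t\to0$; $\ln t=\ln|t|+i\arg t$. *)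

(* Defs.v *)
(* Stdlib reals with Coquelicot's complex numbers [C]. *)
From Stdlib Require Import Reals ZArith.
From Coquelicot Require Import Coquelicot.

Open Scope C_scope.

Definition Cexp (w : C) : C :=
  ((exp (Re w) * cos (Im w))%R, (exp (Re w) * sin (Im w))%R).

(* Solutions branch at t = 0, so they live on the universal covering of a
   punctured neighbourhood of 0.  A point of it is given by l = ln t, that is
   t = Cexp l, |t| = exp (Re l) and arg t = Im l, with arg t any real number.
   A function of t is a function of l, t^a is Cexp (a * l), and t d/dt is the
   complex derivative d/dl. *)

Definition C_deriv_at (f : C -> C) (l f' : C) : Prop :=
  @is_derive C_AbsRing C_NormedModule f l f'.

(* P holds for all t with |arg t| <= M and |t| small enough. *)
Definition near_zero (M : R) (P : C -> Prop) : Prop :=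
  exists rho : R,
    forall l : C, (Rabs (Im l) <= M)%R -> (Re l < rho)%R -> P l.

(* P holds as t -> 0 with arg t bounded; the neighbourhood of 0 may depend on
   the bound. *)
Definition as_t_to_zero (P : C -> Prop) : Prop :=
  forall M : R, near_zero M P.

(* f = O(g) as t -> 0 with arg t bounded; the constant may depend on the
   bound. *)
Definition is_bigO (f g : C -> C) : Prop :=
  forall M : R, exists K : R,
    near_zero M (fun l => (Cmod (f l) <= K * Cmod (g l))%R).

(* The error terms O(t ln^4 t). *)
Definition is_eps (e : C -> C) : Prop :=
  is_bigO e (fun l => Cexp l * l ^ 4).

Definition not_integer (x : C) : Prop := forall n : Z, x <> RtoC (IZR n).

Section IsomonodromySystem.

Variables th0 th1 thoo : C.

(* The equation for t d/dt log u = (t du/dt) / u is multiplied by u. *)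
Definition isomonodromy_system (y z u : C -> C) (l : C) : Prop :=
  y l <> 0 /\ u l <> 0 /\
  C_deriv_at y l
    (Cexp l * y l - 2 * z l * (y l - 1) ^ 2
     - (y l - 1) * ((th0 - th1 + thoo) / 2 * y l
                    - (3 * th0 + th1 + thoo) / 2)) /\
  C_deriv_at z l
    (y l * z l * (z l + (th0 - th1 + thoo) / 2)
     - 1 / y l * (z l + th0) * (z l + (th0 + th1 + thoo) / 2)) /\
  C_deriv_at u l
    (u l * (- 2 * z l - th0
            + y l * (z l + (th0 - th1 + thoo) / 2)
            + 1 / y l * (z l + (th0 + th1 + thoo) / 2))).

Definition zeta (y z : C -> C) (l : C) : C :=
  1 / 4 * ((th0 + thoo) ^ 2 - th1 ^ 2) - z l * Cexp l
  - (z l - 1 / y l * (z l + (th0 + th1 + thoo) / 2))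
    * (z l + th0 - y l * (z l + (th0 - th1 + thoo) / 2)).

Definition par_b : C := (th1 + th0) / 2.
Definition par_c : C := (th1 - th0) / 2.
Definition par_d : C := thoo / 2.

Section LogarithmicSolution.

Variables s r : C.

Let b := par_b.
Let c := par_c.
Let d := par_d.

(* Each occurrence of the error term is a separate function.  Division in C is
   total with x / 0 = 0; as y and u do not vanish on a solution, the equations
   for them below force their denominators to be nonzero. *)

Definition z_log_asymptotics (z : C -> C) : Prop :=
  exists e : C -> C, is_eps e /\
    as_t_to_zero (fun l =>
      z l = - d * b * c * (l + s) ^ 2 + (b * c + (b + c) * d) * (l + s)
            - d - b + e l).

Definition y_log_asymptotics (y : C -> C) : Prop :=
  exists e1 e2 e3 e4 : C -> C,
    is_eps e1 /\ is_eps e2 /\ is_eps e3 /\ is_eps e4 /\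
    as_t_to_zero (fun l =>
      y l = ((- d * b * c * (l + s) + d * b + b * c + c * d + e1 l)
             * (b * (l + s) - 1 + e2 l))
            / ((- b * c * (l + s) + b + c + e3 l)
               * (d * b * (l + s) - b - d + e4 l))).

Definition u_log_asymptotics (den : C -> C) (u : C -> C) : Prop :=
  exists e1 e2 : C -> C, is_eps e1 /\ is_eps e2 /\
    as_t_to_zero (fun l =>
      u l = - r * Cexp (thoo * l)
            * ((d * b * (l + s) - b - d + e1 l) / (den l + e2 l))).

(* The stated denominator of u is db(ln t + s) - 1/2.  With the
   above y and z, the equation for u is compatible with it only if b = 0 or
   d = 1/2; integrating that equation gives b(ln t + s) - 1 instead.  Both
   forms are admitted, so that the definition covers the stated form and is
   not contradictory for the other parameters. *)
Definition logarithmic_solution (y z u : C -> C) : Prop :=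
  as_t_to_zero (isomonodromy_system y z u) /\
  z_log_asymptotics z /\
  y_log_asymptotics y /\
  (u_log_asymptotics (fun l => d * b * (l + s) - 1 / 2) u \/
   u_log_asymptotics (fun l => b * (l + s) - 1) u).

End LogarithmicSolution.

End IsomonodromySystem.

(* Main.v *)
(* On each line arg t = const, t d/dt zeta = - t z, so the expansion of z
   gives that of zeta by integration, up to the constant Z = lim zeta.

   To find Z, eliminate y from the system.  With l = ln t, sg = b - c + d,
   e3 = (d - c)(b - c)(b + d) and Z0 = - bc + (b - c)d,
     d^2 z / dl^2 = 4 (zeta - Z0) z + 2 sg zeta - 2 e3 + t (...).
   If P is the polynomial part of the expansion of z, then z - P tends to 0
   and its second derivative is, up to o(1), the polynomial
   4 (Z - Z0) P + 2 sg Z - 2 e3 - P''.  This polynomial must vanish.  Hence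
   Z = Z0 unless P is constant; then two of b, c, d are 0, and the constant
   term gives Z = Z0 = 0, because b <> c. *)
Require Import Defs.
From Stdlib Require Import Reals ZArith Lra.
From Coquelicot Require Import Coquelicot.

Open Scope C_scope.

(** * Differentiation of complex functions of a real variable *)

(* On the lines arg t = const this is t d/dt. *)
Definition derC (f : R -> C) (x : R) (f' : C) : Prop :=
  is_derive (fun v => Re (f v)) x (Re f') /\
  is_derive (fun v => Im (f v)) x (Im f').

Lemma derC_ext_val f x a b : a = b -> derC f x a -> derC f x b.
Proof. intros ->; auto. Qed.

Lemma derC_ext f g x a : (forall v, f v = g v) -> derC f x a -> derC g x a.
Proof.
  intros E [Hr Hi]; split.
  - apply is_derive_ext with (2 := Hr); intros v; now rewrite E.
  - apply is_derive_ext with (2 := Hi); intros v; now rewrite E.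
Qed.

Lemma derC_const (a : C) x : derC (fun _ => a) x 0.
Proof. split; exact (is_derive_const _ _). Qed.

Lemma derC_plus f g x f' g' :
  derC f x f' -> derC g x g' -> derC (fun v => f v + g v) x (f' + g').
Proof.
  intros [Hr Hi] [Kr Ki]; split.
  - exact (is_derive_plus _ _ _ _ _ Hr Kr).
  - exact (is_derive_plus _ _ _ _ _ Hi Ki).
Qed.

Lemma derC_opp f x f' : derC f x f' -> derC (fun v => - f v) x (- f').
Proof.
  intros [Hr Hi]; split.
  - exact (is_derive_opp _ _ _ Hr).
  - exact (is_derive_opp _ _ _ Hi).
Qed.

Lemma derC_minus f g x f' g' :
  derC f x f' -> derC g x g' -> derC (fun v => f v - g v) x (f' - g').
Proof. intros Hf Hg; exact (derC_plus _ _ _ _ _ Hf (derC_opp _ _ _ Hg)). Qed.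

Lemma derC_mult f g x f' g' :
  derC f x f' -> derC g x g' ->
  derC (fun v => f v * g v) x (f' * g x + f x * g').
Proof.
  intros [Hr Hi] [Kr Ki]; split.
  - eapply is_derive_ext;
      [|evar_last; [apply @is_derive_minus;
        [apply (is_derive_mult _ _ _ _ _ Hr Kr); exact Rmult_comm
        |apply (is_derive_mult _ _ _ _ _ Hi Ki); exact Rmult_comm]|]].
    + intros v; reflexivity.
    + unfold minus, plus, mult, opp, Re, Im; simpl; ring.
  - eapply is_derive_ext;
      [|evar_last; [apply @is_derive_plus;
        [apply (is_derive_mult _ _ _ _ _ Hr Ki); exact Rmult_comm
        |apply (is_derive_mult _ _ _ _ _ Hi Kr); exact Rmult_comm]|]].
    + intros v; reflexivity.
    + unfold plus, mult, opp, Re, Im; simpl; ring.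
Qed.

Lemma Cnorm2_neq_0 (w : C) : w <> 0 -> (Re w ^ 2 + Im w ^ 2 <> 0)%R.
Proof.
  intros Hw E; apply Hw; destruct w as [p q]; unfold Re, Im in E; simpl in E.
  assert (p = 0%R) by nra; assert (q = 0%R) by nra; subst; reflexivity.
Qed.

(** The components of [/ f] are [Re f] and [- Im f] over [Re f ^ 2 + Im f ^ 2], so the real quotient
    rule applies to each. *)
Lemma derC_inv (f : R -> C) x f' :
  f x <> 0 -> derC f x f' -> derC (fun v => / f v) x (- (f' / f x ^ 2)).
Proof.
  intros H0 [Hr Hi].
  assert (N := Cnorm2_neq_0 _ H0).
  (* With [/ f x] taken twice, the only denominator is the squared modulus of [f x], which [N]
     controls; the inverse of [f x ^ 2] would bring in the squared modulus of [f x ^ 2]. *)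
  assert (E : - (f' / f x ^ 2) = - f' * / f x * / f x) by (field; exact H0).
  rewrite E; clear E.
  assert (Hn : is_derive (fun v => (Re (f v) ^ 2 + Im (f v) ^ 2)%R) x
                 (2 * Re (f x) * Re f' + 2 * Im (f x) * Im f')%R).
  { evar_last.
    - apply @is_derive_plus; apply is_derive_pow; eassumption.
    - unfold plus; simpl; ring. }
  split.
  - evar_last; [exact (is_derive_div _ _ _ _ _ Hr Hn N)|].
    change (R_AbsRing : Type) with R in *; unfold Re, Im in *.
    destruct (f x) as [p q]; destruct f' as [p' q']; simpl in *; field;
    contradict N; rewrite <- N; ring.
  - evar_last; [exact (is_derive_div _ _ _ _ _ (is_derive_opp _ _ _ Hi) Hn N)|].
    change (R_AbsRing : Type) with R in *; unfold Re, Im, opp in *.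
    destruct (f x) as [p q]; destruct f' as [p' q']; simpl in *; field;
    contradict N; rewrite <- N; ring.
Qed.

Lemma derC_pow2 f x f' :
  derC f x f' -> derC (fun v => f v ^ 2) x (2 * f x * f').
Proof.
  intros H; apply derC_ext with (fun v => f v * f v).
  - intros v; ring.
  - eapply derC_ext_val; [|exact (derC_mult _ _ _ _ _ H H)]; ring.
Qed.

(** * Restriction to the lines arg t = const *)

Lemma line_eq (x y0 : R) : (x, y0) = RtoC x + (0, y0) :> C.
Proof. unfold RtoC, Cplus; simpl; f_equal; ring. Qed.

Lemma derC_Cexp_line y0 x :
  derC (fun v => Cexp (v, y0)) x (Cexp (x, y0)).
Proof. split; unfold Cexp, Re, Im; simpl; auto_derive; auto; ring. Qed.

Lemma Im_le_Cmod (w : C) : (Rabs (Im w) <= Cmod w)%R.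
Proof. exact (Rle_trans _ _ _ (Rmax_r _ _) (Rmax_Cmod w)). Qed.
Lemma Re_le_Cmod (w : C) : (Rabs (Re w) <= Cmod w)%R.
Proof. exact (Rle_trans _ _ _ (Rmax_l _ _) (Rmax_Cmod w)). Qed.

(** Only real increments of [l] are used; the real and imaginary parts of the error of the
    difference quotient are bounded by its modulus. *)
Lemma C_deriv_at_line (f : C -> C) x y0 f' :
  C_deriv_at f (x, y0) f' -> derC (fun v => f (v, y0)) x f'.
Proof.
  intros [_ H].
  specialize (H (x, y0) (fun P HP => HP)).
  assert (HH : forall eps, (0 < eps)%R -> exists delta : posreal, forall h : R,
    h <> 0%R -> (Rabs h < delta)%R ->
    (Cmod ((f ((x + h)%R, y0) - f (x, y0) - RtoC h * f') / RtoC h) < eps)%R).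
  { intros eps Heps.
    (* The bound supplied by [H] is not strict while a strict one is wanted, hence [eps / 2]. *)
    destruct (H (mkposreal (eps / 2) (is_pos_div_2 (mkposreal eps Heps)))) as [del Hd].
    exists del; intros h h0 hd.
    specialize (Hd ((x + h)%R, y0)).
    assert (E : ((x + h)%R, y0) - (x, y0) = RtoC h).
    { unfold RtoC, Cminus, Cplus, Copp; simpl; f_equal; ring. }
    change (Cmod (((x + h)%R, y0) - (x, y0)) < del ->
      Cmod (f ((x + h)%R, y0) - f (x, y0) - (((x + h)%R, y0) - (x, y0)) * f')
        <= eps / 2 * Cmod (((x + h)%R, y0) - (x, y0)))%R in Hd.
    rewrite E, Cmod_R in Hd.
    rewrite Cmod_div, Cmod_R by (intros Eh; apply h0; now injection Eh).
    assert (0 < Rabs h)%R by now apply Rabs_pos_lt.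
    apply Rle_lt_trans with (eps / 2)%R; [|lra].
    apply Rle_div_l; auto. }
  assert (Hsplit : forall h : R, h <> 0%R ->
    (f ((x + h)%R, y0) - f (x, y0) - RtoC h * f') / RtoC h =
    (((Re (f ((x + h)%R, y0)) - Re (f (x, y0))) / h - Re f')%R,
     ((Im (f ((x + h)%R, y0)) - Im (f (x, y0))) / h - Im f')%R)).
  { intros h h0; destruct (f ((x + h)%R, y0)), (f (x, y0)), f'.
    unfold Cdiv, Cinv, Cminus, Cplus, Cmult, Copp, RtoC, Re, Im; simpl.
    f_equal; field; nra. }
  split; apply is_derive_Reals; intros eps Heps;
    destruct (HH eps Heps) as [del Hd]; exists del; intros h h0 hd;
    (eapply Rle_lt_trans; [|exact (Hd h h0 hd)]); rewrite (Hsplit h h0).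
  - exact (Re_le_Cmod (_, _)).
  - exact (Im_le_Cmod (_, _)).
Qed.

(** * Derivatives of zeta and z along a solution *)

Ltac derC_rule :=
  match goal with
  | |- derC (fun _ => ?k) _ _ => apply (derC_const k)
  | |- derC (fun v => @?f v - @?g v) _ _ => apply (derC_minus f g)
  | |- derC (fun v => @?f v + @?g v) _ _ => apply (derC_plus f g)
  | |- derC (fun v => @?f v * @?g v) _ _ => apply (derC_mult f g)
  | |- derC (fun v => - @?f v) _ _ => apply (derC_opp f)
  | |- derC (fun v => (@?f v) ^ 2) _ _ => apply (derC_pow2 f)
  | |- derC (fun v => / @?f v) _ _ => apply (derC_inv f); [eassumption|]
  | H : derC ?f _ _ |- derC ?f _ _ => exact H
  end.

(** This is [zeta' = - z] multiplied by [t], with [th0 = b - c], [th1 = b + c], [thoo = 2 d]. Once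
    the system is substituted, it is an identity of rational functions of y, z and t in which only y
    is inverted. *)
Lemma derive_zeta_line (b c d : C) (y z u : C -> C) (x y0 : R) :
  isomonodromy_system (b - c) (b + c) (2 * d) y z u (x, y0) ->
  derC (fun v => zeta (b - c) (b + c) (2 * d) y z (v, y0)) x
    (- (Cexp (x, y0) * z (x, y0))).
Proof.
  intros (Hy0 & _ & Hy & Hz & _).
  apply C_deriv_at_line in Hy; apply C_deriv_at_line in Hz.
  assert (Ht := derC_Cexp_line y0 x).
  unfold zeta, Cdiv.
  eapply derC_ext_val; [|repeat derC_rule].
  cbv beta; revert Hy0.
  generalize (y (x, y0)), (z (x, y0)), (Cexp (x, y0)); intros Y Z T Hy0.
  field; exact Hy0.
Qed.

(* Second derivative of z, its first derivative being taken from the system.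
   It no longer involves y: the two summands of dz/dl have a sum expressible by
   z, t, zeta and a product polynomial in z (the sigma form of Painleve V). *)
Lemma derive2_z_line (b c d : C) (y z u : C -> C) (x y0 : R)
    (t := Cexp (x, y0)) (w := z (x, y0))
    (ze := zeta (b - c) (b + c) (2 * d) y z (x, y0)) :
  isomonodromy_system (b - c) (b + c) (2 * d) y z u (x, y0) ->
  derC (fun v =>
    y (v, y0) * z (v, y0) * (z (v, y0) + (d - c))
    - / y (v, y0) * (z (v, y0) + (b - c)) * (z (v, y0) + (b + d))) x
   ((ze + w * t + 2 * w * (w + (b - c + d))) * (t + 4 * w + 2 * (b - c + d))
    - 2 * (4 * w ^ 3 + 6 * (b - c + d) * w ^ 2
        + 2 * ((d - c) * (b - c) + (d - c) * (b + d) + (b - c) * (b + d)) * w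
        + (d - c) * (b - c) * (b + d))).
Proof.
  unfold ze, w, t; clear ze w t.
  intros (Hy0 & _ & Hy & Hz & _).
  apply C_deriv_at_line in Hy; apply C_deriv_at_line in Hz.
  eapply derC_ext_val; [|repeat derC_rule].
  unfold zeta; cbv beta; revert Hy0.
  generalize (y (x, y0)), (z (x, y0)), (Cexp (x, y0)); intros Y Z T Hy0.
  field; exact Hy0.
Qed.

(** * Limits at -oo of functions with dominated derivative *)

Lemma MVT_le (f f' : R -> R) p q :
  (p <= q)%R -> (forall x, (p <= x <= q)%R -> is_derive f x (f' x)) ->
  exists x, (p <= x <= q)%R /\ (f q - f p = f' x * (q - p))%R.
Proof.
  intros pq D.
  destruct (MVT_gen f p q f') as (x & Hx & E);
    rewrite ?Rmin_left, ?Rmax_right in * by exact pq.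
  - intros x Hx; apply D; lra.
  - intros x Hx; apply continuity_pt_filterlim.
    apply (ex_derive_continuous f x); exists (f' x); apply D; lra.
  - now exists x.
Qed.

(* The limit of [f] at [-oo], obtained as the supremum of [f - h]. *)
Lemma limit_of_dominated_derivative (f f' h h' : R -> R) rho :
  (forall x, (x < rho)%R -> is_derive f x (f' x)) ->
  (forall x, (x < rho)%R -> is_derive h x (h' x)) ->
  (forall x, (x < rho)%R -> Rabs (f' x) <= h' x)%R ->
  (forall x, 0 <= h x)%R ->
  exists l : R, forall x, (x < rho)%R -> (Rabs (f x - l) <= h x)%R.
Proof.
  intros Df Dh Hle Hpos.
  (* Both [h - f] and [h + f] have nonnegative derivatives. *)
  assert (incr : forall p q, (p <= q)%R -> (q < rho)%R ->
    (Rabs (f q - f p) <= h q - h p)%R).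
  { intros p q pq qr.
    destruct (MVT_le (fun x => h x - f x)%R (fun x => h' x - f' x)%R p q pq)
      as (x & Hx & E).
    { intros x Hx; apply @is_derive_minus; [apply Dh|apply Df]; lra. }
    destruct (MVT_le (fun x => h x + f x)%R (fun x => h' x + f' x)%R p q pq)
      as (x' & Hx' & E').
    { intros v Hv; apply @is_derive_plus; [apply Dh|apply Df]; lra. }
    assert (B := proj1 (Rabs_le_between _ _) (Hle x ltac:(lra))).
    assert (B' := proj1 (Rabs_le_between _ _) (Hle x' ltac:(lra))).
    apply Rabs_le; nra. }
  (* Every value of [f - h] lies below every value of [f + h], so the supremum of the former is
     within [h x] of each [f x]. *)
  assert (cross : forall p q, (p < rho)%R -> (q < rho)%R ->
    (f p - h p <= f q + h q)%R).
  { intros p q pr qr; assert (P := Hpos p); assert (Q := Hpos q).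
    destruct (Rle_dec p q) as [pq|pq].
    - assert (B := proj1 (Rabs_le_between _ _) (incr p q pq qr)); lra.
    - assert (B := proj1 (Rabs_le_between _ _) (incr q p ltac:(lra) pr)); lra. }
  destruct (completeness (fun v => exists x, (x < rho)%R /\ v = (f x - h x)%R))
    as [l [ub lub]].
  - exists (f (rho - 1) + h (rho - 1))%R; intros v (x & xr & ->).
    apply cross; lra.
  - exists (f (rho - 1) - h (rho - 1))%R; exists (rho - 1)%R; split; [lra|auto].
  - exists l; intros x xr; apply Rabs_le.
    assert (f x - h x <= l)%R by (apply ub; now exists x).
    assert (l <= f x + h x)%R
      by (apply lub; intros v (p & pr & ->); now apply cross).
    lra.
Qed.

Lemma Cmod_le_Re_Im (w : C) : (Cmod w <= Rabs (Re w) + Rabs (Im w))%R.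
Proof.
  unfold Cmod, Re, Im.
  assert (P := Rabs_pos (fst w)); assert (Q := Rabs_pos (snd w)).
  rewrite <- (sqrt_Rsqr (Rabs (fst w) + Rabs (snd w))) by lra.
  apply sqrt_le_1_alt; rewrite <- (pow2_abs (fst w)), <- (pow2_abs (snd w)).
  unfold Rsqr; nra.
Qed.

(** The real and imaginary parts each contribute an error [h x], whence the factor 2. *)
Lemma Climit_of_dominated_derivative (f f' : R -> C) (h h' : R -> R) rho :
  (forall x, (x < rho)%R -> derC f x (f' x)) ->
  (forall x, (x < rho)%R -> is_derive h x (h' x)) ->
  (forall x, (x < rho)%R -> Cmod (f' x) <= h' x)%R ->
  (forall x, 0 <= h x)%R ->
  exists l : C, forall x, (x < rho)%R -> (Cmod (f x - l) <= 2 * h x)%R.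
Proof.
  intros Df Dh Hle Hpos.
  destruct (limit_of_dominated_derivative (fun x => Re (f x))
    (fun x => Re (f' x)) h h' rho) as [p Hp]; auto.
  { intros x xr; apply Df, xr. }
  { intros x xr; eapply Rle_trans; [apply Re_le_Cmod|auto]. }
  destruct (limit_of_dominated_derivative (fun x => Im (f x))
    (fun x => Im (f' x)) h h' rho) as [q Hq]; auto.
  { intros x xr; apply Df, xr. }
  { intros x xr; eapply Rle_trans; [apply Im_le_Cmod|auto]. }
  exists (p, q); intros x xr.
  eapply Rle_trans; [apply Cmod_le_Re_Im|].
  assert (P := Hp x xr); assert (Q := Hq x xr).
  unfold Re, Im in *; simpl; unfold Rminus in *; lra.
Qed.

(** * Quadratic polynomials as asymptotic second derivatives *)

Definition tends_to_0 (f : R -> R) : Prop :=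
  forall eta, (0 < eta)%R ->
  exists rho, forall x, (x < rho)%R -> (Rabs (f x) < eta)%R.

(** For nonzero [p], to the left of [- (B + |q|) / |p|] the term [p x] alone exceeds [B + |q|] in
    modulus. *)
Lemma slope_eq_0 p q B :
  (forall rho, exists x, (x < rho)%R /\ (Rabs (p * x + q) <= B)%R) -> p = 0%R.
Proof.
  intros H; destruct (Req_dec p 0) as [|p0]; auto; exfalso.
  assert (pp := Rabs_pos_lt p p0).
  destruct (H (- ((B + Rabs q) / Rabs p))%R) as (x & xr & Hx).
  assert (T := Rabs_triang_inv (p * x) (- q)).
  replace (p * x - - q)%R with (p * x + q)%R in T by ring.
  rewrite Rabs_Ropp, Rabs_mult in T.
  assert (B + Rabs q < - x * Rabs p)%R by (apply Rlt_div_l; lra).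
  assert (- x <= Rabs x)%R by (rewrite <- Rabs_Ropp; apply Rle_abs).
  nra.
Qed.

(* The second difference of [f] tends to 0 and is a value of [f''], so the
   quadratic polynomial has arbitrarily small values arbitrarily far away. *)
Lemma quadratic_second_derivative_eq_0 (f f' f'' : R -> R) p q k rho :
  (forall x, (x < rho)%R -> is_derive f x (f' x)) ->
  (forall x, (x < rho)%R -> is_derive f' x (f'' x)) ->
  tends_to_0 f -> tends_to_0 (fun x => f'' x - (p * x ^ 2 + q * x + k))%R ->
  (p = 0 /\ q = 0 /\ k = 0)%R.
Proof.
  intros D1 D2 F0 R0.
  assert (small : forall eta r, (0 < eta)%R ->
    exists x, (x < r)%R /\ (Rabs (p * x ^ 2 + q * x + k) < eta)%R).
  { intros eta r Heta.
    (* The second difference [f x - 2 f (x - 1) + f (x - 2)] has total weight 4, so it is below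
       [eta / 2]; the error of the polynomial adds [eta / 8]. *)
    destruct (F0 (eta / 8)%R) as [r1 H1]; [lra|].
    destruct (R0 (eta / 8)%R) as [r2 H2]; [lra|].
    set (x := (Rmin (Rmin rho r) (Rmin r1 r2) - 1)%R).
    assert (x < rho /\ x < r /\ x < r1 /\ x < r2)%R as (? & ? & ? & ?).
    { assert (M1 := Rmin_l (Rmin rho r) (Rmin r1 r2)).
      assert (M2 := Rmin_r (Rmin rho r) (Rmin r1 r2)).
      assert (M3 := Rmin_l rho r); assert (M4 := Rmin_r rho r).
      assert (M5 := Rmin_l r1 r2); assert (M6 := Rmin_r r1 r2).
      unfold x; lra. }
    destruct (MVT_le (fun v => f v - f (v - 1))%R
      (fun v => f' v - f' (v - 1))%R (x - 1) x) as (v & Hv & Ev).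
    { lra. }
    { intros v Hv; apply @is_derive_minus; [apply D1; lra|].
      evar_last; [apply (is_derive_comp f (fun v => v - 1)%R);
        [apply D1; lra|auto_derive; auto]|].
      unfold scal; simpl; unfold mult; simpl; ring. }
    destruct (MVT_le f' f'' (v - 1) v) as (w & Hw & Ew).
    { lra. }
    { intros w Hw; apply D2; lra. }
    exists w; split; [lra|].
    assert (A1 := Rabs_def2 _ _ (H1 x ltac:(lra))).
    assert (A2 := Rabs_def2 _ _ (H1 (x - 1)%R ltac:(lra))).
    assert (A3 := Rabs_def2 _ _ (H1 (x - 1 - 1)%R ltac:(lra))).
    assert (A4 := Rabs_def2 _ _ (H2 w ltac:(lra))).
    apply Rabs_def1; lra. }
  (* For [x < -1], a bound on [(p x + q) x + k] bounds [p x + q] by [1 + |k|], and its slope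
     vanishes. *)
  assert (p = 0)%R as ->.
  { apply (slope_eq_0 p q (1 + Rabs k)); intros r.
    destruct (small 1%R (Rmin r (-1)) Rlt_0_1) as (x & xr & Hx).
    assert (M1 := Rmin_l r (-1)); assert (M2 := Rmin_r r (-1)).
    exists x; split; [lra|].
    assert (T := Rabs_triang_inv ((p * x + q) * x) (- k)).
    replace ((p * x + q) * x - - k)%R with (p * x ^ 2 + q * x + k)%R in T by ring.
    rewrite Rabs_Ropp, Rabs_mult, (Rabs_left x) in T by lra.
    assert (A := Rabs_pos (p * x + q)); nra. }
  assert (q = 0)%R as ->.
  { apply (slope_eq_0 q k 1); intros r.
    destruct (small 1%R r Rlt_0_1) as (x & xr & Hx).
    exists x; split; [lra|].
    replace (q * x + k)%R with (0 * x ^ 2 + q * x + k)%R by ring; lra. }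
  repeat split.
  destruct (Req_dec k 0) as [|k0]; auto.
  destruct (small (Rabs k) 0%R (Rabs_pos_lt k k0)) as (x & _ & Hx).
  replace (0 * x ^ 2 + 0 * x + k)%R with k in Hx by ring; lra.
Qed.

(** * Orders of growth along a line *)

(* O(|t|^(p - eps)) for every eps > 0, along a line arg t = const: powers of
   ln t are absorbed by eps. *)
Definition expO (p : R) (f : R -> C) : Prop :=
  forall eps, (0 < eps)%R -> exists K rho, (0 <= K)%R /\
  forall x, (x < rho)%R -> (Cmod (f x) <= K * exp ((p - eps) * x))%R.

Lemma expO_le p f g K rho :
  (forall x, (x < rho)%R -> Cmod (f x) <= K * Cmod (g x))%R ->
  expO p g -> expO p f.
Proof.
  intros H Hg eps He; destruct (Hg eps He) as (K' & r & HK & Hr).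
  exists (Rabs K * K')%R, (Rmin rho r); split.
  { apply Rmult_le_pos; [apply Rabs_pos|auto]. }
  intros x Hx; assert (M1 := Rmin_l rho r); assert (M2 := Rmin_r rho r).
  assert (A := H x ltac:(lra)); assert (B := Hr x ltac:(lra)).
  assert (P := Cmod_ge_0 (g x)).
  assert (Q := Rle_abs K); assert (Q' := Rabs_pos K); nra.
Qed.

Lemma expO_ext p f g rho :
  (forall x, (x < rho)%R -> f x = g x) -> expO p g -> expO p f.
Proof.
  intros H; apply expO_le with 1%R rho; intros x xr; rewrite (H x xr); lra.
Qed.

Lemma expO_const (k : C) : expO 0 (fun _ => k).
Proof.
  intros eps He; exists (Cmod k), 0%R; split; [apply Cmod_ge_0|].
  intros x Hx; assert (E := exp_ineq1_le ((0 - eps) * x)).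
  assert (1 <= exp ((0 - eps) * x))%R by nra.
  assert (A := Cmod_ge_0 k); nra.
Qed.

(** The inequality [1 + v <= exp v] at [v = - eps x] gives [eps |x| <= exp (- eps x)], whence the
    constant [/ eps]. *)
Lemma expO_id : expO 0 RtoC.
Proof.
  intros eps He; exists (/ eps)%R, 0%R; split.
  { left; now apply Rinv_0_lt_compat. }
  intros x Hx; rewrite Cmod_R, Rabs_left by auto.
  assert (E := exp_ineq1_le ((0 - eps) * x)).
  apply Rmult_le_reg_l with eps; auto.
  rewrite <- Rmult_assoc, Rinv_r, Rmult_1_l; lra.
Qed.

Lemma expO_plus p f g : expO p f -> expO p g -> expO p (fun x => f x + g x).
Proof.
  intros Hf Hg eps He.
  destruct (Hf eps He) as (K & r & HK & Hr).
  destruct (Hg eps He) as (K' & r' & HK' & Hr').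
  exists (K + K')%R, (Rmin r r'); split; [lra|].
  intros x Hx; assert (M1 := Rmin_l r r'); assert (M2 := Rmin_r r r').
  assert (A := Hr x ltac:(lra)); assert (B := Hr' x ltac:(lra)).
  assert (T := Cmod_triangle (f x) (g x)); lra.
Qed.

Lemma expO_mult p q f g :
  expO p f -> expO q g -> expO (p + q) (fun x => f x * g x).
Proof.
  intros Hf Hg eps He.
  destruct (Hf (eps / 2)%R ltac:(lra)) as (K & r & HK & Hr).
  destruct (Hg (eps / 2)%R ltac:(lra)) as (K' & r' & HK' & Hr').
  exists (K * K')%R, (Rmin r r'); split; [now apply Rmult_le_pos|].
  intros x Hx; assert (M1 := Rmin_l r r'); assert (M2 := Rmin_r r r').
  rewrite Cmod_mult.
  replace ((p + q - eps) * x)%R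
    with ((p - eps / 2) * x + (q - eps / 2) * x)%R by field.
  rewrite exp_plus.
  replace (K * K' * (exp ((p - eps / 2) * x) * exp ((q - eps / 2) * x)))%R
    with (K * exp ((p - eps / 2) * x) * (K' * exp ((q - eps / 2) * x)))%R by ring.
  apply Rmult_le_compat; try apply Cmod_ge_0; [apply Hr|apply Hr']; lra.
Qed.

Lemma exp_le x x' : (x <= x')%R -> (exp x <= exp x')%R.
Proof.
  intros [Hlt| ->]; [left; now apply exp_increasing|apply Rle_refl].
Qed.

Lemma expO_weaken p q f : (q <= p)%R -> expO p f -> expO q f.
Proof.
  intros qp Hf eps He; destruct (Hf eps He) as (K & r & HK & Hr).
  exists K, (Rmin r 0); split; auto.
  intros x Hx; assert (M1 := Rmin_l r 0); assert (M2 := Rmin_r r 0).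
  eapply Rle_trans; [apply Hr; lra|].
  apply Rmult_le_compat_l; auto; apply exp_le; nra.
Qed.

Lemma Cmod_Cexp l : Cmod (Cexp l) = exp (Re l).
Proof.
  unfold Cmod, Cexp; simpl.
  transitivity (sqrt (Rsqr (exp (Re l)))).
  - f_equal; assert (E := sin2_cos2 (Im l)); unfold Rsqr in *; nra.
  - apply sqrt_Rsqr; left; apply exp_pos.
Qed.

Lemma expO_Cexp y0 : expO 1 (fun x => Cexp (x, y0)).
Proof.
  intros eps He; exists 1%R, 0%R; split; [lra|]; intros x Hx.
  rewrite Cmod_Cexp, Rmult_1_l; apply exp_le; simpl; nra.
Qed.

Lemma expO_line y0 : expO 0 (fun x => (x, y0) : C).
Proof.
  apply expO_ext with (fun x => RtoC x + (0, y0)) 0%R.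
  - intros x _; apply line_eq.
  - apply expO_plus; [apply expO_id|apply expO_const].
Qed.

Lemma expO_tends_to_0 p f : (0 < p)%R -> expO p f -> tends_to_0 (fun x => Cmod (f x)).
Proof.
  intros p0 Hf eta Heta; destruct (Hf (p / 2)%R ltac:(lra)) as (K & r & HK & Hr).
  (* To the left of this point the remaining factor [exp (p x / 2)] is below [eta / (K + 1)]; the
     denominator [K + 1] is positive even for [K = 0]. *)
  exists (Rmin r (ln (eta / (K + 1)) / (p / 2))).
  intros x Hx.
  assert (M1 := Rmin_l r (ln (eta / (K + 1)) / (p / 2))).
  assert (M2 := Rmin_r r (ln (eta / (K + 1)) / (p / 2))).
  rewrite Rabs_pos_eq by apply Cmod_ge_0.
  eapply Rle_lt_trans; [apply Hr; lra|].
  assert (E : (exp ((p - p / 2) * x) < eta / (K + 1))%R).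
  { rewrite <- (exp_ln (eta / (K + 1))) by (apply Rdiv_lt_0_compat; lra).
    apply exp_increasing.
    assert (x < ln (eta / (K + 1)) / (p / 2))%R as Hx' by lra.
    apply Rlt_div_r in Hx'; lra. }
  apply Rlt_div_r in E; [|lra].
  assert (P := exp_pos ((p - p / 2) * x)); nra.
Qed.

Lemma tends_to_0_le (f g : R -> R) :
  (forall x, Rabs (f x) <= Rabs (g x))%R -> tends_to_0 g -> tends_to_0 f.
Proof.
  intros H Hg eta Heta; destruct (Hg eta Heta) as [rho Hr]; exists rho.
  intros x xr; eapply Rle_lt_trans; [apply H|auto].
Qed.

(** As [x] is real, the real and imaginary parts of the coefficients separate, and the real case
    applies to each. *)
Lemma Cquadratic_second_derivative_eq_0 (f f' f'' : R -> C) (p q k : C) rho :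
  (forall x, (x < rho)%R -> derC f x (f' x)) ->
  (forall x, (x < rho)%R -> derC f' x (f'' x)) ->
  expO 1 f -> expO 1 (fun x => f'' x - (p * (x * x) + q * x + k)) ->
  p = 0 /\ q = 0 /\ k = 0.
Proof.
  intros D1 D2 F0 R0.
  apply (expO_tends_to_0 _ _ Rlt_0_1) in F0.
  apply (expO_tends_to_0 _ _ Rlt_0_1) in R0.
  destruct (quadratic_second_derivative_eq_0 (fun x => Re (f x))
    (fun x => Re (f' x)) (fun x => Re (f'' x)) (Re p) (Re q) (Re k) rho)
    as (P & Q & S).
  { intros x xr; apply D1, xr. }
  { intros x xr; apply D2, xr. }
  { revert F0; apply tends_to_0_le; intros x.
    rewrite (Rabs_pos_eq (Cmod _)) by apply Cmod_ge_0; apply Re_le_Cmod. }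
  { revert R0; apply tends_to_0_le; intros x.
    rewrite (Rabs_pos_eq (Cmod _)) by apply Cmod_ge_0.
    eapply Rle_trans; [|apply Re_le_Cmod]; right; f_equal.
    unfold Re; simpl; ring. }
  destruct (quadratic_second_derivative_eq_0 (fun x => Im (f x))
    (fun x => Im (f' x)) (fun x => Im (f'' x)) (Im p) (Im q) (Im k) rho)
    as (P' & Q' & S').
  { intros x xr; apply D1, xr. }
  { intros x xr; apply D2, xr. }
  { revert F0; apply tends_to_0_le; intros x.
    rewrite (Rabs_pos_eq (Cmod _)) by apply Cmod_ge_0; apply Im_le_Cmod. }
  { revert R0; apply tends_to_0_le; intros x.
    rewrite (Rabs_pos_eq (Cmod _)) by apply Cmod_ge_0.
    eapply Rle_trans; [|apply Im_le_Cmod]; right; f_equal.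
    unfold Im; simpl; ring. }
  destruct p, q, k; unfold Re, Im in *; simpl in *; subst; auto.
Qed.

Lemma derC_line y0 x : derC (fun v => (v, y0)) x 1.
Proof.
  split; simpl; auto_derive; auto.
Qed.

(** The even power removes the square root, leaving an elementary function of [x] that can be
    differentiated and used as a dominating primitive. *)
Lemma Cmod_Cexp_pow_line m x y0 :
  Cmod (Cexp (x, y0) ^ m * (x, y0) ^ 4)
  = (exp x ^ m * (x ^ 2 + y0 ^ 2) ^ 2)%R.
Proof.
  rewrite Cmod_mult, !Cmod_pow, Cmod_Cexp; simpl Re.
  f_equal; unfold Cmod; simpl fst; simpl snd.
  replace 4%nat with (2 * 2)%nat by reflexivity.
  rewrite pow_mult, pow2_sqrt; auto.
  apply Rplus_le_le_0_compat; apply pow2_ge_0.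
Qed.

Lemma expO_opp p f : expO p f -> expO p (fun x => - f x).
Proof.
  apply expO_le with 1%R 0%R; intros x _; rewrite Cmod_opp; lra.
Qed.

Lemma expO_minus p f g : expO p f -> expO p g -> expO p (fun x => f x - g x).
Proof. intros Hf Hg; exact (expO_plus _ _ _ Hf (expO_opp _ _ Hg)). Qed.

Lemma expO_mult_l p f g :
  expO 0 f -> expO p g -> expO p (fun x => f x * g x).
Proof.
  intros Hf Hg; rewrite <- (Rplus_0_l p); now apply expO_mult.
Qed.

Lemma expO_pow f n : expO 0 f -> expO 0 (fun x => f x ^ n).
Proof.
  intros Hf; induction n as [|n IH]; [exact (expO_const 1)|].
  apply expO_ext with (fun x => f x * f x ^ n) 0%R; [|now apply expO_mult_l].
  reflexivity.
Qed.

(** In a product the left factor is taken of order 0, so a decaying factor has to be written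
    last. *)
Ltac expO_rule :=
  match goal with
  | H : expO _ ?f |- expO _ ?f => exact H
  | |- expO 0 (fun x => (x, ?y0)) => apply (expO_line y0)
  | |- expO 0 (fun _ => ?k) => apply (expO_const k)
  | |- expO 1 (fun x => Cexp (x, ?y0)) => apply (expO_Cexp y0)
  | |- expO ?p (fun x => @?f x - @?g x) => apply (expO_minus p f g)
  | |- expO ?p (fun x => @?f x + @?g x) => apply (expO_plus p f g)
  | |- expO ?p (fun x => @?f x * @?g x) => apply (expO_mult_l p f g)
  | |- expO ?p (fun x => - @?f x) => apply (expO_opp p f)
  | |- expO 0 (fun x => (@?f x) ^ ?n) => apply (expO_pow f n)
  | |- expO 0 (fun x => Cexp (x, ?y0)) =>
      apply (expO_weaken 1 0); [lra|apply (expO_Cexp y0)]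
  end.

(** * Degenerate parameters and the expansion on one line *)

Lemma Cmult_eq_0_cancel_l (k w : C) : k <> 0 -> k * w = 0 -> w = 0.
Proof.
  intros Hk E; replace w with (k * w / k) by (field; exact Hk).
  rewrite E; field; exact Hk.
Qed.

(** The two vanishing expressions are, up to sign, the nonconstant coefficients of the expansion of
    z in powers of [l + s]. If [b c] were nonzero, the first would give [d = 0] and the second then
    [b c = 0]. *)
Lemma nongeneric_parameters (b c d : C) :
  d * b * c = 0 -> b * c + (b + c) * d = 0 -> b - c <> 0 ->
  d = 0 /\ ((b = 0 /\ c <> 0) \/ (c = 0 /\ b <> 0)).
Proof.
  intros H1 H2 Hbc.
  destruct (Ceq_dec b 0) as [Hb|Hb].
  - subst b.
    assert (Hc : c <> 0) by (intros Hc; apply Hbc; rewrite Hc; ring).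
    split; auto; apply (Cmult_eq_0_cancel_l c); auto; rewrite <- H2; ring.
  - destruct (Ceq_dec c 0) as [Hc|Hc].
    + subst c; split; auto.
      apply (Cmult_eq_0_cancel_l b); auto; rewrite <- H2; ring.
    + exfalso; assert (Hd : d = 0).
      { apply (Cmult_eq_0_cancel_l (b * c)); [now apply Cmult_neq_0|].
        rewrite <- H1; ring. }
      apply Hc, (Cmult_eq_0_cancel_l b); auto; rewrite <- H2, Hd; ring.
Qed.

(** Integration of [zeta' = - z] from [t = 0]. The constants [K] and [rho] are explicit so that the
    estimate can be made uniform in arg t. *)
Lemma zeta_expansion_line (b c d s : C) (y z u e : C -> C) (y0 rho K : R) :
  (rho <= -4)%R -> (0 <= K)%R -> b - c <> 0 ->
  (forall x, (x < rho)%R ->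
    isomonodromy_system (b - c) (b + c) (2 * d) y z u (x, y0)) ->
  (forall x, (x < rho)%R ->
    z (x, y0) = - d * b * c * ((x, y0) + s) ^ 2
                + (b * c + (b + c) * d) * ((x, y0) + s) - d - b + e (x, y0)) ->
  (forall x, (x < rho)%R ->
    Cmod (e (x, y0)) <= K * Cmod (Cexp (x, y0) * (x, y0) ^ 4))%R ->
  forall x, (x < rho)%R ->
  (Cmod (zeta (b - c) (b + c) (2 * d) y z (x, y0)
     - (- b * c + (b - c) * d
        + Cexp (x, y0) * ((x, y0) + s)
          * (d * b * c * ((x, y0) + s)
             - d * b - b * c - c * d - 2 * b * c * d)
        + Cexp (x, y0) * (b + d + d * b + b * c + c * d + 2 * d * b * c)))
   <= 2 * K * Cmod (Cexp (x, y0) ^ 2 * (x, y0) ^ 4))%R.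
Proof.
  intros Hrho HK Hbc Hsys Hz He.
  set (ze := fun v => zeta (b - c) (b + c) (2 * d) y z (v, y0)).
  (* This is a primitive of [- t P], where [P] is the polynomial part of z, so [ze - m] has
     derivative [- t e]. *)
  set (m := fun v : R => Cexp (v, y0) * ((v, y0) + s)
          * (d * b * c * ((v, y0) + s)
             - d * b - b * c - c * d - 2 * b * c * d)
        + Cexp (v, y0) * (b + d + d * b + b * c + c * d + 2 * d * b * c)).
  destruct (Climit_of_dominated_derivative (fun v => ze v - m v)
    (fun v => - (Cexp (v, y0) * e (v, y0)))
    (fun v => K * (exp v ^ 2 * (v ^ 2 + y0 ^ 2) ^ 2))%R
    (fun v => K * (exp v ^ 2 * (2 * (v ^ 2 + y0 ^ 2) ^ 2
                                + 4 * v * (v ^ 2 + y0 ^ 2))))%R rho)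
    as [Z HZ].
  { intros x xr.
    assert (Dze := derive_zeta_line b c d y z u x y0 (Hsys x xr)).
    fold ze in Dze.
    assert (Dl := derC_line y0 x); assert (Dt := derC_Cexp_line y0 x).
    unfold m; eapply derC_ext_val; [|repeat derC_rule].
    cbv beta; rewrite (Hz x xr); ring. }
  { intros x _; auto_derive; auto; ring. }
  { intros x xr; rewrite Cmod_opp, Cmod_mult, Cmod_Cexp; simpl Re.
    assert (B := He x xr).
    replace (Cexp (x, y0) * (x, y0) ^ 4)
      with (Cexp (x, y0) ^ 1 * (x, y0) ^ 4) in B by ring.
    rewrite Cmod_Cexp_pow_line in B.
    assert (P := exp_pos x).
    set (N := (x ^ 2 + y0 ^ 2)%R) in *.
    (* Here [x < -4] enters: the inequality gives [N ^ 2 <= 2 N ^ 2 + 4 x N], so the derivative of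
       [K exp (2 x) N ^ 2] dominates [|t e|]. *)
    assert (HN : (- 4 * x <= N)%R) by (unfold N; nra).
    apply Rle_trans with (exp x * (K * (exp x ^ 1 * N ^ 2)))%R.
    - apply Rmult_le_compat_l; [now left|exact B].
    - replace (exp x * (K * (exp x ^ 1 * N ^ 2)))%R
        with (K * (exp x ^ 2 * N ^ 2))%R by ring.
      repeat apply Rmult_le_compat_l; auto; [apply pow2_ge_0|nra]. }
  { intros x; apply Rmult_le_pos; auto.
    apply Rmult_le_pos; apply pow2_ge_0. }
  assert (Ee : expO 1 (fun x => e (x, y0))).
  { apply (expO_le _ _ _ _ _ He).
    apply expO_ext with (fun x => (x, y0) ^ 4 * Cexp (x, y0)) 0%R.
    - intros; ring.
    - repeat expO_rule. }
  assert (Ez : expO 0 (fun x => z (x, y0))).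
  { apply (expO_ext _ _ _ _ Hz).
    assert (Ee0 := expO_weaken 1 0 _ Rle_0_1 Ee).
    repeat expO_rule. }
  assert (Eze : expO 1 (fun x => ze x - Z)).
  { apply expO_ext with (fun x => (ze x - m x - Z) + m x) 0%R; [intros; ring|].
    apply expO_plus.
    - apply expO_le with (fun x => Cexp (x, y0) ^ 2 * (x, y0) ^ 4) (2 * K)%R rho.
      + intros x xr; rewrite Cmod_Cexp_pow_line, Rmult_assoc; apply HZ, xr.
      + apply expO_ext with
          (fun x => (Cexp (x, y0) * (x, y0) ^ 4) * Cexp (x, y0)) 0%R.
        * intros; ring.
        * repeat expO_rule.
    - apply expO_ext with (fun x => (((x, y0) + s)
          * (d * b * c * ((x, y0) + s)
             - d * b - b * c - c * d - 2 * b * c * d)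
        + (b + d + d * b + b * c + c * d + 2 * d * b * c)) * Cexp (x, y0)) 0%R.
      + intros; unfold m; ring.
      + repeat expO_rule. }
  assert (Eze0 : expO 0 ze).
  { apply expO_ext with (fun x => (ze x - Z) + Z) 0%R; [intros; ring|].
    apply expO_plus; [apply (expO_weaken 1 0 _ Rle_0_1 Eze)|apply expO_const]. }
  set (Z0 := - b * c + (b - c) * d).
  set (sg := b - c + d).
  set (e3 := (d - c) * (b - c) * (b + d)).
  (* On the line [l + s = x + q] with [x] real; the coefficients below are those of
     [4 (Z - Z0) P + 2 sg Z - 2 e3 - P''] in powers of [x]. *)
  set (q := (0, y0) + s).
  destruct (Cquadratic_second_derivative_eq_0
    (fun v => z (v, y0) - (- d * b * c * ((v, y0) + s) ^ 2
                + (b * c + (b + c) * d) * ((v, y0) + s) - d - b))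
    (fun v => y (v, y0) * z (v, y0) * (z (v, y0) + (d - c))
       - / y (v, y0) * (z (v, y0) + (b - c)) * (z (v, y0) + (b + d))
       - (- 2 * d * b * c * ((v, y0) + s) + (b * c + (b + c) * d)))
    (fun v => ((ze v + z (v, y0) * Cexp (v, y0)
                + 2 * z (v, y0) * (z (v, y0) + sg))
               * (Cexp (v, y0) + 4 * z (v, y0) + 2 * sg)
      - 2 * (4 * z (v, y0) ^ 3 + 6 * sg * z (v, y0) ^ 2
        + 2 * ((d - c) * (b - c) + (d - c) * (b + d) + (b - c) * (b + d))
            * z (v, y0) + e3)) + 2 * d * b * c)
    (- 4 * (Z - Z0) * (d * b * c))
    (4 * (Z - Z0) * (b * c + (b + c) * d - 2 * d * b * c * q))
    (4 * (Z - Z0) * (- d * b * c * q ^ 2 + (b * c + (b + c) * d) * q - d - b)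
     + 2 * sg * Z - 2 * e3 + 2 * d * b * c) rho) as (Hp & Hq & Hk).
  { intros x xr.
    assert (Dl := derC_line y0 x).
    destruct (Hsys x xr) as (Hy0 & _ & _ & Dz & _).
    apply C_deriv_at_line in Dz.
    eapply derC_ext_val; [|repeat derC_rule].
    cbv beta; field; exact Hy0. }
  { intros x xr.
    assert (Dl := derC_line y0 x).
    assert (Dz := derive2_z_line b c d y z u x y0 (Hsys x xr)).
    eapply derC_ext_val; [|apply derC_minus; [exact Dz|repeat derC_rule]].
    unfold ze, sg, e3; cbv beta; ring. }
  { apply (expO_ext _ _ (fun x => e (x, y0)) rho); [|exact Ee].
    intros x xr; rewrite (Hz x xr); ring. }
  (* The cubes and squares of z cancel, since [2 sg] is the sum of [d - c], [b - c] and [b + d].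
     What remains carries a factor [ze - Z], [e] or [t], each of order 1. *)
  { apply expO_ext with (fun x => (4 * z (x, y0) + 2 * sg) * (ze x - Z)
       + 4 * (Z - Z0) * e (x, y0)
       + (ze x + z (x, y0) * Cexp (x, y0) + 2 * z (x, y0) * (z (x, y0) + sg)
          + z (x, y0) * (4 * z (x, y0) + 2 * sg)) * Cexp (x, y0)) rho.
    - intros x xr.
      assert (E : e (x, y0) = z (x, y0) - (- d * b * c * (x + q) ^ 2
                + (b * c + (b + c) * d) * (x + q) - d - b)).
      { rewrite (Hz x xr).
        replace (x + q) with ((x, y0) + s)
          by (rewrite (line_eq x y0); unfold q; ring).
        ring. }
      rewrite E; unfold Z0, sg, e3; ring.
    - repeat expO_rule. }
  (* If Z <> Z0 then z is asymptotically constant, which leaves two special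
     cases, where the constant term still gives Z = Z0 = 0. *)
  assert (EZ : Z = Z0).
  { destruct (Ceq_dec Z Z0) as [|HZZ]; auto; exfalso.
    assert (HD : Z - Z0 <> 0).
    { intros E; apply HZZ; replace Z with (Z - Z0 + Z0) by ring.
      rewrite E; ring. }
    assert (Hdbc : d * b * c = 0).
    { apply (Cmult_eq_0_cancel_l (-4 * (Z - Z0))); [|exact Hp].
      apply Cmult_neq_0; auto; intros E; apply (f_equal Re) in E; simpl in E; lra. }
    assert (Hsum : b * c + (b + c) * d = 0).
    { replace (b * c + (b + c) * d)
        with (b * c + (b + c) * d - 2 * d * b * c * q + 2 * (d * b * c) * q)
        by ring.
      rewrite (Cmult_eq_0_cancel_l (4 * (Z - Z0)) _) with (2 := Hq); [rewrite Hdbc; ring|].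
      apply Cmult_neq_0; auto; intros E; apply (f_equal Re) in E; simpl in E; lra. }
    (* The constant coefficient is [-2 c Z] for [b = d = 0] and [-2 b Z] for [c = d = 0]. *)
    destruct (nongeneric_parameters _ _ _ Hdbc Hsum Hbc) as [Hd [[Hb Hc]|[Hc Hb]]];
      apply HD; [apply (Cmult_eq_0_cancel_l (-2 * c))
                |apply (Cmult_eq_0_cancel_l (-2 * b))];
      try (apply Cmult_neq_0; auto; intros E; apply (f_equal Re) in E; simpl in E; lra);
      rewrite <- Hk; unfold Z0, sg, e3; [rewrite Hd, Hb|rewrite Hd, Hc]; ring. }
  intros x xr; rewrite Cmod_Cexp_pow_line, Rmult_assoc.
  eapply Rle_trans; [|apply HZ, xr]; right; f_equal.
  rewrite EZ; unfold ze, m, Z0; ring.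
Qed.

(** * From single lines to bounded arg t *)

Theorem corollary7p2 :
  forall (th0 th1 thoo s r : C) (y z u : C -> C),
  not_integer th0 -> not_integer th1 -> r <> 0 ->
  logarithmic_solution th0 th1 thoo s r y z u ->
  forall b c d : C,
  b = (th1 + th0) / 2 -> c = (th1 - th0) / 2 -> d = thoo / 2 ->
  is_bigO
    (fun l =>
       zeta th0 th1 thoo y z l
       - (- b * c + (b - c) * d
          + Cexp l * (l + s)
            * (d * b * c * (l + s)
               - d * b - b * c - c * d - 2 * b * c * d)
          + Cexp l * (b + d + d * b + b * c + c * d + 2 * d * b * c)))
    (fun l => Cexp l ^ 2 * l ^ 4).
Proof.
  intros th0 th1 thoo s r y z u Hth0 _ _ (Hsys & (e & He & Hz) & _) b c d Eb Ec Ed.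
  change (par_b th0 th1) with ((th1 + th0) / 2) in Hz.
  change (par_c th0 th1) with ((th1 - th0) / 2) in Hz.
  change (par_d thoo) with (thoo / 2) in Hz.
  rewrite <- Eb, <- Ec, <- Ed in Hz.
  assert (E0 : th0 = b - c) by (rewrite Eb, Ec; field).
  assert (E1 : th1 = b + c) by (rewrite Eb, Ec; field).
  assert (Eoo : thoo = 2 * d) by (rewrite Ed; field).
  clear Eb Ec Ed; subst th0 th1 thoo.
  intros M.
  destruct (Hsys M) as [r1 H1]; destruct (He M) as (K & r2 & H2).
  destruct (Hz M) as [r3 H3].
  (* These depend on [M] only, hence serve all lines at once. The given [K] may be negative, and
     [-4] is the threshold of the line estimate. *)
  exists (2 * Rabs K)%R, (Rmin (Rmin r1 r2) (Rmin r3 (-4))).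
  intros [x y0] HM Hx; simpl in HM, Hx.
  assert (M1 := Rmin_l (Rmin r1 r2) (Rmin r3 (-4))).
  assert (M2 := Rmin_r (Rmin r1 r2) (Rmin r3 (-4))).
  assert (M3 := Rmin_l r1 r2); assert (M4 := Rmin_r r1 r2).
  assert (M5 := Rmin_l r3 (-4)); assert (M6 := Rmin_r r3 (-4)).
  (* The condition [b - c <> 0] holds because [b - c] is [th0], which differs from the integer 0. *)
  apply (zeta_expansion_line b c d s y z u e y0
    (Rmin (Rmin r1 r2) (Rmin r3 (-4))) (Rabs K)); auto.
  - lra.
  - apply Rabs_pos.
  - intros v vr; apply H1; simpl; auto; lra.
  - intros v vr; apply H3; simpl; auto; lra.
  - intros v vr; eapply Rle_trans; [apply H2; simpl; auto; lra|].
    apply Rmult_le_compat_r; [apply Cmod_ge_0|apply Rle_abs].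
Qed.
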